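(* Let $F$ be a properly parametrized Markov multi-map of $[0,1]$ with forward trajectory system $(X,T)$ and associated shift of finite type $\Sigma_M$. Suppose that $\Sigma_M$ satisfies the Coding Condition (CC) and the Mixing Condition (MC), and let $\mathcal{C}_0\subset\mathcal{A}$ be the mixing component with $\mathcal{A}^{(e)}\subset\mathcal{C}_0$. If the family $\{g_u:u\in\mathcal{L}(\mathcal{C}_0)\}$ is uniformly equicontinuous, then $(X,T)$ has the specification property.
   Context: **Markov multi-maps.** $2^{[0,1]}$ denotes the set of closed subsets of $[0,1]$. A Markov multi-map of $[0,1]$ is given by a tuple $F=(P,\mathcal{A}_0,\mathcal{A}_1,\mathcal{A}_2,D,R,\{f_a\}_{a\in\mathcal{A}_0})$ such that: (1) $P=\{p_0,\dots,p_r\}$ with $0=p_0<\dots<p_r=1$; (2) $\mathcal{A}=\mathcal{A}_0\sqcup\mathcal{A}_1\sqcup\mathcal{A}_2$ is a finite set; (3) $D:\mathcal{A}\to 2^{[0,1]}$, and for each $a\in\mathcal{A}$ there is $p_i\in P$ with $D(a)=[p_i,p_{i+1}]$ if $a\in\mathcal{A}_0$ and $D(a)=\{p_i\}$ if $a\in\mathcal{A}_1\cup\mathcal{A}_2$; (4) $R:\mathcal{A}\to 2^{[0,1]}$, and for each $a\in\mathcal{A}$ there are $u\le v$ in $P$ with $R(a)=[u,v]$, where $u<v$ if $a\in\mathcal{A}_0$; $u<v$ and $R(a)\cap P=\{u,v\}$ if $a\in\mathcal{A}_1$; $u=v$ if $a\in\mathcal{A}_2$; (5) for each $a\in\mathcal{A}_0$,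 $f_a:D(a)\to R(a)$ is a homeomorphism; (6) $[0,1]=\bigcup_{a\in\mathcal{A}}D(a)$. For $a\in\mathcal{A}_0$ let $G(a)$ be the graph of $f_a$; for $a\in\mathcal{A}_1\cup\mathcal{A}_2$ let $G(a)=D(a)\times R(a)$. The multi-map $F:[0,1]\to 2^{[0,1]}$ has graph $G(F)=\bigcup_{a\in\mathcal{A}}G(a)$, i.e. $y\in F(x)$ iff $(x,y)\in G(F)$. If $a\in\mathcal{A}_0$ with $D(a)=[p_i,p_{i+1}]$, $R(a)=[u,v]$: $D_0(a)=(p_i,p_{i+1})$, $R_0(a)=(u,v)$, $G_0(a)$ = graph of $f_a|_{D_0(a)}$. If $a\in\mathcal{A}_1$ with $D(a)=\{p\}$, $R(a)=[u,v]$: $D_0(a)=\{p\}$, $R_0(a)=(u,v)$, $G_0(a)=\{p\}\times(u,v)$. If $a\in\mathcal{A}_2$ with $D(a)=\{p\}$, $R(a)=\{q\}$: $D_0(a)=\{p\}$, $R_0(a)=\{q\}$, $G_0(a)=\{(p,q)\}$. $F$ is properly parametrized if $\{G_0(a):a\in\mathcal{A}\}$ is a partition of $G(F)$. **Trajectories.** $X=\{x\in[0,1]^{\mathbb{Z}_{\ge0}}:x_{k+1}\in F(x_k)\ \forall k\ge0\}$ with the subspace topology of the product topology, given by the metric $d(x,y)=\sup_{k\ge0}|x_k-y_k|/(k+1)$, and $T:X\to X$, $T(x)_k=x_{k+1}$. For $n\ge 1$, $X_n=\{(x_0,\dots,x_{n-1})\in[0,1]^n:(x_i,x_{i+1})\in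 G(F),\ 0\le i\le n-2\}$ with the subspace topology. **Specification.** A system $(X,f)$ on a compact metric space has the specification property if for all $\epsilon>0$ there is $N\ge0$ such that for any $x_1,\dots,x_l\in X$, any positive integers $a_1\le b_1<a_2\le b_2<\cdots<a_l\le b_l$ with $a_{i+1}-b_i\ge N$ for $i=1,\dots,l-1$, and any $p\ge b_l+N$, there is $z\in X$ with $f^p(z)=z$ and $d(f^i(z),f^i(x_k))<\epsilon$ for all $k=1,\dots,l$ and $a_k\le i\le b_k$. **Associated SFT.** $M(a,b)=1$ if $D_0(b)\subset R_0(a)$ and $M(a,b)=0$ otherwise ($a,b\in\mathcal{A}$). $\Sigma_M=\{\mathbf{a}\in\mathcal{A}^{\mathbb{Z}_{\ge0}}:M(a_n,a_{n+1})=1\ \forall n\ge 0\}$, with left shift $\sigma$. For $Z\subset\Sigma_M$, $\mathcal{L}_n(Z)$ is the set of words of length $n$ appearing in points of $Z$, $\mathcal{L}(Z)=\bigcup_n\mathcal{L}_n(Z)$; $\mathcal{L}_n=\mathcal{L}_n(\Sigma_M)$, $\mathcal{L}=\mathcal{L}(\Sigma_M)$. For $\mathcal{C}\subset\mathcal{A}$, $\Sigma_M(\mathcal{C})$ is the set of points of $\Sigma_M$ using only symbols of $\mathcal{C}$, $\mathcal{L}_n(\mathcal{C})=\mathcal{L}_n(\Sigma_M(\mathcal{C}))$ and $\mathcal{L}(\mathcal{C})=\mathcal{L}(\Sigma_M(\mathcal{C}))$. A subshift $Z\subset\Sigma_M$ is a closed set with $\sigma(Z)\subset Z$; it is transitive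 on symbols if for all $a,b\in\mathcal{L}_1(Z)$ some word in $\mathcal{L}(Z)$ starts with $a$ and ends with $b$. **Inverse functions.** For $a\in\mathcal{A}_0$, $g_a=f_a^{-1}$; for $a\in\mathcal{A}_1\cup\mathcal{A}_2$, $g_a:R(a)\to D(a)$ is the constant map. For $u=u_0\cdots u_n\in\mathcal{L}$, $g_u=g_{u_0}\circ\cdots\circ g_{u_n}$ (defined on $R(u_n)$) and $I_u=g_u(R(u_n))$. For a possibly degenerate interval, $\ell([p,q])=q-p$. A family $\{g_\omega:\omega\in\Omega\}$ of functions, $g_\omega$ defined on a compact (possibly degenerate) interval $J_\omega\subset[0,1]$, is uniformly equicontinuous if for every $\epsilon>0$ there is $\delta>0$ such that for all $\omega\in\Omega$ and $x,y\in J_\omega$ with $|x-y|<\delta$, $|g_\omega(x)-g_\omega(y)|<\epsilon$. **Coding Condition (CC).** There is a subshift $Z\subset\Sigma_M$, transitive on symbols, such that (i) for every $y\in[0,1]$ there are $\mathbf{a}\in Z$ and $x\in X$ with $x_0=y$ and $(x_i,x_{i+1})\in G(a_i)$ for all $i\ge0$; and (ii) $\lim_{n\to\infty}\max_{u\in\mathcal{L}_n(Z)}\ell(I_u)=0$. **Essential symbols.** A word $u=u_0\cdots u_{n-1}\in\mathcal{L}_n$ is essential if $\{x\in X_{n+1}:(x_k,x_{k+1})\in G_0(u_k),\ 0\le k\le n-1\}$ is open in $X_{n+1}$. A symbol is essential if it appears in some essential word; $\mathcal{A}^{(e)}$ is the set of essential symbols. **Mixing Condition (MC).** A set $\mathcal{C}\subset\mathcal{A}$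 is mixing if there is $N\ge1$ such that for all $a,b\in\mathcal{C}$ and all $n\ge N$ there is a word in $\mathcal{L}_n(\mathcal{C})$ beginning with $a$ and ending with $b$; a mixing component is a maximal mixing subset of $\mathcal{A}$. $\Sigma_M$ satisfies (MC) if there is a mixing component $\mathcal{C}\subset\mathcal{A}$ with $\mathcal{A}^{(e)}\subset\mathcal{C}$. *)

(* Defs.v *)
From HB Require Import structures.
From mathcomp Require Import all_boot all_order all_algebra.
From mathcomp Require Import all_classical all_reals all_analysis.

Set Implicit Arguments.
Unset Strict Implicit.
Unset Printing Implicit Defensive.

Import Order.TTheory GRing.Theory Num.Theory.
Import numFieldNormedType.Exports.

Local Open Scope classical_set_scope.
Local Open Scope ring_scope.

Definition left_shift (S : Type) (x : nat -> S) : nat -> S := fun k => x k.+1.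

Definition homeomorphism_on (R : realType) (A B : set R) (f : R -> R) : Prop :=
  [/\ set_bij A B f, {within A, continuous f}
    & {within B, continuous (pinv A f)}].

(* The partition P is {p 0, ..., p r}; the values p i for i > r are junk, as
   are the values of f a outside D(a).  The sets D(a) and R(a) determine, and
   are determined by, the index [mm_i a] of the (left) endpoint of D(a) and the
   endpoints [mm_u a <= mm_v a] of R(a); these are recorded as the data, and
   the sets are defined from them in [mm_D] and [mm_R]. *)
Record markov_multimap (R : realType) := MarkovMultimap {
  mm_r : nat;
  mm_p : nat -> R;
  mm_A0 : finType;
  mm_A1 : finType;
  mm_A2 : finType;
  mm_i : (mm_A0 + mm_A1 + mm_A2)%type -> nat;
  mm_u : (mm_A0 + mm_A1 + mm_A2)%type -> R;
  mm_v : (mm_A0 + mm_A1 + mm_A2)%type -> R;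
  mm_f : mm_A0 -> R -> R;
  mm_P := [set mm_p i | i in [set i | (i <= mm_r)%N]];
  mm_D := fun a : (mm_A0 + mm_A1 + mm_A2)%type =>
    match a with
    | inl (inl _) => `[mm_p (mm_i a), mm_p (mm_i a).+1]
    | _ => [set mm_p (mm_i a)]
    end%classic;
  mm_R := fun a : (mm_A0 + mm_A1 + mm_A2)%type =>
    (`[mm_u a, mm_v a])%classic;
  mm_p_first : mm_p 0%N = 0;
  mm_p_last : mm_p mm_r = 1;
  mm_p_lt : forall i, (i < mm_r)%N -> mm_p i < mm_p i.+1;
  mm_i0 : forall a : mm_A0, (mm_i (inl (inl a)) < mm_r)%N;
  mm_i1 : forall a : mm_A1, (mm_i (inl (inr a)) <= mm_r)%N;
  mm_i2 : forall a : mm_A2, (mm_i (inr a) <= mm_r)%N;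
  mm_uP : forall a, mm_P (mm_u a);
  mm_vP : forall a, mm_P (mm_v a);
  mm_uv0 : forall a : mm_A0, mm_u (inl (inl a)) < mm_v (inl (inl a));
  mm_uv1 : forall a : mm_A1, mm_u (inl (inr a)) < mm_v (inl (inr a)) /\
    mm_R (inl (inr a)) `&` mm_P = [set mm_u (inl (inr a)); mm_v (inl (inr a))];
  mm_uv2 : forall a : mm_A2, mm_u (inr a) = mm_v (inr a);
  mm_homeo : forall a : mm_A0,
    homeomorphism_on (mm_D (inl (inl a))) (mm_R (inl (inl a))) (mm_f a);
  mm_cover : `[0, 1]%classic = \bigcup_a mm_D a
}.

Definition alphabet (R : realType) (F : markov_multimap R) : finType :=
  (mm_A0 F + mm_A1 F + mm_A2 F)%type.

Section multimap.
Variables (R : realType) (F : markov_multimap R).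

Let A : finType := alphabet F.

Definition D0 (a : A) : set R :=
  match a with
  | inl (inl _) => `]mm_p F (mm_i a), mm_p F (mm_i a).+1[
  | _ => mm_D a
  end%classic.

Definition R0 (a : A) : set R :=
  match a with
  | inr _ => mm_R a
  | _ => `]mm_u a, mm_v a[
  end%classic.

Definition G (a : A) : set (R * R) :=
  match a with
  | inl (inl a0) => [set xy | mm_D a xy.1 /\ xy.2 = mm_f a0 xy.1]
  | _ => mm_D a `*` mm_R a
  end.

Definition G0 (a : A) : set (R * R) :=
  match a with
  | inl (inl a0) => [set xy | D0 a xy.1 /\ xy.2 = mm_f a0 xy.1]
  | _ => D0 a `*` R0 a
  end.

Definition GF : set (R * R) := \bigcup_a G a.

Definition multimap (x : R) : set R := [set y | GF (x, y)].

Definition properly_parametrized : Prop := partition [set: A] G0 GF.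

Definition trajectories : set (nat -> R) :=
  [set x | (forall k, `[0, 1]%classic (x k)) /\
           (forall k, multimap (x k) (x k.+1))].

Definition trajectories_fin (n : nat) : set 'rV[R]_n :=
  [set x | (forall i, `[0, 1]%classic (x ord0 i)) /\
           (forall i j : 'I_n, j = i.+1 :> nat -> GF (x ord0 i, x ord0 j))].

Definition M (a b : A) : Prop := D0 b `<=` R0 a.

Definition Sigma_M : set (nat -> A) := [set s | forall n, M (s n) (s n.+1)].

Definition Sigma_M_on (C : set A) : set (nat -> A) :=
  Sigma_M `&` [set s | forall n, C (s n)].

Definition words_n (Z : set (nat -> A)) (n : nat) : set (seq A) :=
  [set w | exists2 s, Z s & exists k, w = mkseq (fun i => s (k + i)%N) n].

Definition words (Z : set (nat -> A)) : set (seq A) :=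
  \bigcup_n words_n Z n.

Definition subshift (Z : set (nat -> A)) : Prop :=
  [/\ Z `<=` Sigma_M,
      closed (Z : set {ptws nat -> discrete_topology A})
    & forall s, Z s -> Z (left_shift s)].

Definition transitive_on_symbols (Z : set (nat -> A)) : Prop :=
  forall a b, words_n Z 1 [:: a] -> words_n Z 1 [:: b] ->
    exists2 w, words Z (a :: w) & last a w = b.

Definition g (a : A) : R -> R :=
  match a with
  | inl (inl a0) => pinv (mm_D a) (mm_f a0)
  | _ => fun=> mm_p F (mm_i a)
  end.

(* For u = u_0 ... u_n, [g_word u] is g_(u_0) \o ... \o g_(u_n), to be
   considered on [g_word_dom u] = R(u_n) only; the empty word, for which the
   composition is not defined, gets the empty domain. *)
Definition g_word (u : seq A) : R -> R := foldr (fun a h => g a \o h) id u.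

Definition g_word_dom (u : seq A) : set R :=
  if u is a :: u' then mm_R (last a u') else set0.

Definition I_word (u : seq A) : set R := g_word u @` g_word_dom u.

Definition ell (J : set R) : R := sup J - inf J.

Definition coding_condition : Prop :=
  exists Z : set (nat -> A),
  [/\ subshift Z, transitive_on_symbols Z,
      forall y : R, `[0, 1]%classic y ->
        exists (s : nat -> A) (x : nat -> R),
        [/\ Z s, trajectories x, x 0%N = y
          & forall i, G (s i) (x i, x i.+1)]
    & (fun n => \big[Num.max/0]_(u : n.-tuple A | `[< words_n Z n u >])
                  ell (I_word u)) @ \oo --> (0 : R)].

Definition essential_word (n : nat) (u : n.-tuple A) : Prop :=
  words_n Sigma_M n u /\
  open ([set x | trajectories_fin x /\
          forall k : 'I_n,
            G0 (tnth u k) (x ord0 (widen_ord (leqnSn n) k),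
                           x ord0 (lift ord0 k))]
        : set (subspace (@trajectories_fin n.+1))).

Definition essential_symbols : set A :=
  [set a | exists n (u : n.-tuple A), essential_word u /\ a \in u].

Definition mixing (C : set A) : Prop :=
  exists2 N : nat, (1 <= N)%N &
    forall a b, C a -> C b -> forall n, (N <= n)%N ->
      exists2 w, words_n (Sigma_M_on C) n (a :: w) & last a w = b.

Definition mixing_component (C : set A) : Prop :=
  mixing C /\ forall C', mixing C' -> C `<=` C' -> C' = C.

Definition mixing_condition : Prop :=
  exists2 C, mixing_component C & essential_symbols `<=` C.

End multimap.

Arguments Sigma_M {R} F _.
Arguments trajectories_fin {R} F n _.
Arguments Sigma_M_on {R} F C _.
Arguments mixing {R} F C.
Arguments mixing_component {R} F C.
Arguments essential_symbols {R} F _.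
Arguments g_word {R} F u _.
Arguments g_word_dom {R} F u _.

Definition uniformly_equicontinuous (R : realType) (Omega : Type)
    (P : set Omega) (J : Omega -> set R) (h : Omega -> R -> R) : Prop :=
  forall eps : R, 0 < eps -> exists2 delta : R, 0 < delta &
    forall w x y, P w -> J w x -> J w y -> `|x - y| < delta ->
      `|h w x - h w y| < eps.

Definition traj_dist (R : realType) (x y : nat -> R) : R :=
  sup [set `|x k - y k| / k.+1%:R | k in [set: nat]].

(* The system is the restriction of f to the f-invariant set Y, with the metric
   d on Y.  The points x_1, ..., x_l and integers a_k, b_k are the values of
   x, a, b at the indices 1 <= k <= l. *)
Definition specification (R : realType) (S : Type) (Y : set S)
    (d : S -> S -> R) (f : S -> S) : Prop :=
  forall eps : R, 0 < eps -> exists N : nat,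
    forall (l : nat) (x : nat -> S) (a b : nat -> nat), (1 <= l)%N ->
      (forall k, (1 <= k <= l)%N -> Y (x k)) ->
      (forall k, (1 <= k <= l)%N -> (1 <= a k <= b k)%N) ->
      (forall k, (1 <= k < l)%N ->
        (b k < a k.+1)%N /\ (N <= a k.+1 - b k)%N) ->
      forall p : nat, (b l + N <= p)%N ->
        exists z, [/\ Y z, iter p f z = z
          & forall k, (1 <= k <= l)%N -> forall i, (a k <= i <= b k)%N ->
              d (iter i f z) (iter i f (x k)) < eps].

(* Main.v *)
(* The strata [{x | (x_k, x_(k+1)) \in G0(u_k), k < n}] partition [X_(n+1)], and
   the closure of a stratum contains every stratum it meets.  Hence a word whose
   stratum is maximal for the closure order is essential, and every orbit
   segment lies in the closure of a maximal stratum, so that it is coded by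
   symbols of [C0].  To shadow the segment, the endpoint is moved to a generic
   nearby point of the stratum, whose further orbit avoids [P]; the coding that
   (CC) provides for this point uses only symbols of [A0], and appending it
   keeps the word maximal.  By (CC) any orbit following the extended word is
   close to the given one at the end of the segment, and by equicontinuity of the
   [g_u] it is close along the whole segment.  Mixing of [C0] glues such words
   into a periodic sequence [c], which is realized by a periodic orbit because
   [g_(c_0) \o ... \o g_(c_(p-1))] is a continuous self-map of the interval
   [R(c_(p-1))] and so has a fixed point. *)

Require Import Defs.
From mathcomp Require Import all_boot all_order all_algebra.
From mathcomp Require Import all_classical all_reals all_analysis.
From mathcomp Require Import lra zify.

Set Implicit Arguments.
Unset Strict Implicit.
Unset Printing Implicit Defensive.

Import Order.TTheory GRing.Theory Num.Theory.
Import numFieldNormedType.Exports.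

Local Open Scope classical_set_scope.
Local Open Scope ring_scope.

(** * Graphs of the symbols *)

Section letters.
Variables (R : realType) (F : markov_multimap R).
Implicit Types (a b : alphabet F) (x y : R).

Definition is_A0 a : bool := if a is inl (inl _) then true else false.

Definition is_A2 a : bool := if a is inr _ then true else false.

Lemma mm_p_le i j : (i <= j)%N -> (j <= mm_r F)%N -> mm_p F i <= mm_p F j.
Proof.
move=> ij; rewrite -(subnKC ij); elim: (j - i)%N => [|k IH]; first by rewrite addn0.
rewrite addnS => kr; apply: le_trans (IH (ltnW kr)) _.
exact/ltW/mm_p_lt.
Qed.

Lemma mm_p_in01 i : (i <= mm_r F)%N -> 0 <= mm_p F i <= 1.
Proof.
by move=> ir; rewrite -(mm_p_first F) -(mm_p_last F) !mm_p_le.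
Qed.

Lemma mm_P_p i : (i <= mm_r F)%N -> mm_P F (mm_p F i).
Proof. by exists i. Qed.

Lemma mm_P_gt q i : mm_P F q -> (i < mm_r F)%N -> mm_p F i < q ->
  mm_p F i.+1 <= q.
Proof.
move=> [j /= jr <-] ir ij; apply: mm_p_le => //.
by rewrite ltnNge; apply: contraTN ij => ji; rewrite -leNgt mm_p_le // ltnW.
Qed.

Lemma mm_P_lt q i : mm_P F q -> (i < mm_r F)%N -> q < mm_p F i.+1 ->
  q <= mm_p F i.
Proof.
by move=> Pq ir; apply: contraTT; rewrite -leNgt -ltNge; exact: mm_P_gt.
Qed.

Lemma mm_P_in01 q : mm_P F q -> 0 <= q <= 1.
Proof. by move=> [i /= ir <-]; exact: mm_p_in01. Qed.

Lemma finite_mm_P : finite_set (mm_P F).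
Proof.
apply: finite_image; apply: (@sub_finite_set _ _ `I_(mm_r F).+1) => //.
Qed.

Lemma mm_u_le_v a : mm_u a <= mm_v a.
Proof.
by case: a => [[a|a]|a]; [rewrite ltW ?mm_uv0|case: (mm_uv1 a) => /ltW|rewrite mm_uv2].
Qed.

Lemma mm_R_in01 a x : mm_R a x -> 0 <= x <= 1.
Proof.
rewrite /mm_R /= in_itv /= => /andP[ux xv].
have /andP[u0 _] := mm_P_in01 (mm_uP a).
have /andP[_ v1] := mm_P_in01 (mm_vP a).
by rewrite (le_trans u0 ux) (le_trans xv v1).
Qed.

Lemma mm_R_avoid_P a y : mm_R a y -> ~ mm_P F y -> mm_u a < y < mm_v a.
Proof.
rewrite /mm_R /= in_itv /= => /andP[uy yv] nPy.
rewrite !lt_neqAle uy yv !andbT; apply/andP; split; apply/eqP => yE; apply: nPy.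
  by rewrite -yE; exact: mm_uP.
by rewrite yE; exact: mm_vP.
Qed.

Lemma mm_i_le a : (mm_i a <= mm_r F)%N.
Proof.
by case: a => [[a|a]|a]; [exact/ltnW/mm_i0|exact: mm_i1|exact: mm_i2].
Qed.

Lemma mm_D_point a x : ~~ is_A0 a -> mm_D a x = (x = mm_p F (mm_i a)).
Proof. by case: a => [[a|a]|a]. Qed.

Lemma D0_subset_D a : D0 a `<=` mm_D a.
Proof.
by case: a => [[a|a]|a] //= x /=; rewrite !in_itv /= => /andP[/ltW-> /ltW->].
Qed.

Lemma R0_subset_R a : R0 a `<=` mm_R a.
Proof.
by case: a => [[a|a]|a] //= x /=; rewrite /mm_R /= !in_itv /= => /andP[/ltW-> /ltW->].
Qed.

Lemma mm_R_A2 a x y : is_A2 a -> mm_R a x -> mm_R a y -> x = y.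
Proof.
case: a => // a _; rewrite /mm_R /= !in_itv /= -mm_uv2.
by move=> /le_anti <- /le_anti <-.
Qed.

(** [D0 b] is a point or an open interval between neighbouring points of [P], while the endpoints of
    [R0 a] lie in [P] and so cannot cut it: one common point forces inclusion. *)
Lemma M_of_meet a b y : R0 a y -> D0 b y -> M a b.
Proof.
case: b => [[b|b]|b]; last 2 first.
- by rewrite /M /D0 !mm_D_point // => Ray yE z; rewrite mm_D_point // -yE => ->.
- by rewrite /M /D0 !mm_D_point // => Ray yE z; rewrite mm_D_point // -yE => ->.
have ib := mm_i0 b.
move=> Ray /=; rewrite in_itv /= => /andP[py yp] z /=.
rewrite in_itv /= => /andP[pz zp].
have uvR : R0 a y -> mm_u a <= y <= mm_v a.
  by move=> /R0_subset_R; rewrite /mm_R /= in_itv.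
have /andP[uy yv] := uvR Ray.
have up := mm_P_lt (mm_uP a) ib (le_lt_trans uy yp).
have vp := mm_P_gt (mm_vP a) ib (lt_le_trans py yv).
have uz := le_lt_trans up pz; have zv := lt_le_trans zp vp.
case: a {Ray uvR} uy yv up vp uz zv => [[a|a]|a] uy yv up vp uz zv.
- by rewrite /= in_itv /= uz zv.
- by rewrite /= in_itv /= uz zv.
- by rewrite /R0 /mm_R /= in_itv /= !ltW.
Qed.

Lemma D0_neq0 a : D0 a !=set0.
Proof.
case: a => [[a|a]|a].
- exists ((mm_p F (mm_i (inl (inl a))) + mm_p F (mm_i (inl (inl a))).+1) / 2).
  by have := mm_p_lt (mm_i0 a); rewrite /= in_itv /= => h; apply/andP; split; lra.
- by eexists; rewrite /D0 mm_D_point.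
- by eexists; rewrite /D0 mm_D_point.
Qed.

(** Since [R a] contains a point of [D0 b], its endpoints, being in [P], lie on or beyond those of
    [D b]; so the closed sets are nested too. *)
Lemma M_D_subset_R a b : M a b -> mm_D b `<=` mm_R a.
Proof.
move=> Mab; have [y Dy] := D0_neq0 b.
have := R0_subset_R (Mab _ Dy).
case: b Mab Dy => [[b|b]|b] Mab; last 2 first.
- by rewrite /D0 mm_D_point // => yE Ry z; rewrite mm_D_point // -yE => ->.
- by rewrite /D0 mm_D_point // => yE Ry z; rewrite mm_D_point // -yE => ->.
have ib := mm_i0 b.
rewrite /= in_itv /= => /andP[py yp]; rewrite /mm_R /= in_itv /= => /andP[uy yv] z /=.
rewrite !in_itv /= => /andP[pz zp].
have up := mm_P_lt (mm_uP a) ib (le_lt_trans uy yp).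
have vp := mm_P_gt (mm_vP a) ib (lt_le_trans py yv).
by rewrite (le_trans up pz) (le_trans zp vp).
Qed.

(* A homeomorphism between compact intervals is monotone, so that it maps
   endpoints to endpoints. *)
Lemma mm_f_interior (a : mm_A0 F) x : mm_D (inl (inl a)) x ->
  R0 (inl (inl a)) (mm_f a x) <-> D0 (inl (inl a)) x.
Proof.
have [fbij fc _] := mm_homeo a.
have [fim finj fsurj] := fbij.
have pp := mm_p_lt (mm_i0 a); have uv := mm_uv0 a.
move: fim finj fsurj fc pp uv; rewrite /mm_D /mm_R /D0 /R0.
move: (mm_p F _) (mm_p F _) (mm_u _) (mm_v _) => q p u v fim finj fsurj fc pq uv.
rewrite /= !in_itv /= => /andP[px xq].
have I_p : p \in `[p, q] by rewrite in_itv /= lexx ltW.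
have I_q : q \in `[p, q] by rewrite in_itv /= lexx ltW.
have I_x : x \in `[p, q] by rewrite in_itv /= px xq.
have fI z : z \in `[p, q] -> u <= mm_f a z <= v.
  by move=> zI; have := fim z zI; rewrite /= in_itv.
have inj : {in `[p, q] &, injective (mm_f a)}.
  by move=> s t sI tI; apply: finj; rewrite inE.
have [s sI fs] : exists2 s, s \in `[p, q] & mm_f a s = u.
  have [|s sI fs] := fsurj u; first by rewrite /= in_itv /= lexx ltW.
  by exists s.
have [t tI ft] : exists2 t, t \in `[p, q] & mm_f a t = v.
  have [|t tI ft] := fsurj v; first by rewrite /= in_itv /= lexx ltW.
  by exists t.
have := sI; rewrite in_itv /= => /andP[ps sq].
have := tI; rewrite in_itv /= => /andP[pt tq].
have [fle|fge] := leP (mm_f a p) (mm_f a q).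
  have mono := segment_continuous_inj_le fle fc inj.
  have fp : mm_f a p = u.
    apply/eqP; rewrite eq_le; have /andP[-> _] := fI _ I_p.
    by rewrite -fs mono // ps.
  have fq : mm_f a q = v.
    apply/eqP; rewrite eq_le; have /andP[_ ->] := fI _ I_q.
    by rewrite -ft mono // tq.
  by rewrite -fp -fq !(leW_mono_in mono).
have mono : {in `[p, q] &, {mono (mm_f a) : x y /~ x <= y}}.
  by apply: itv_continuous_inj_ge => //; exists p, q; split => //; exact: ltW.
have fp : mm_f a p = v.
  apply/eqP; rewrite eq_le; have /andP[_ ->] := fI _ I_p.
  by rewrite -ft mono // pt.
have fq : mm_f a q = u.
  apply/eqP; rewrite eq_le; have /andP[-> _] := fI _ I_q.
  by rewrite -fs mono // sq.
by rewrite -fp -fq !(leW_nmono_in mono) // andbC.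
Qed.

Lemma G_g a x y : G a (x, y) -> [/\ mm_D a x, mm_R a y & x = g a y].
Proof.
case: a => [[a|a]|a].
- move=> [/= Dx ->]; have [[fim finj _] _ _] := mm_homeo a; split => //.
    exact: fim.
  by rewrite /g pinvKV ?inE.
- by move=> [/= -> Ry].
- by move=> [/= -> Ry].
Qed.

Lemma g_G a y : mm_R a y -> G a (g a y, y).
Proof.
case: a => [[a|a]|a] Ry; last 2 first.
- by split.
- by split.
have [[_ finj fsurj] _ _] := mm_homeo a.
have [x Dx <-] := fsurj y Ry.
by rewrite /g pinvKV ?inE.
Qed.

Lemma g_G0 a y : R0 a y -> G0 a (g a y, y).
Proof.
move=> R0y; have := g_G (R0_subset_R R0y).
case: a R0y => [[a|a]|a] R0y; last 2 first.
- by move=> [].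
- by move=> [].
move=> [/= Dg fg]; split=> //; apply/(mm_f_interior Dg).
by rewrite -fg.
Qed.

Lemma G0_subset_G a : G0 a `<=` G a.
Proof.
case: a => [[a|a]|a] [x y] //.
- by move=> [Dx yE]; split => //; exact: (@D0_subset_D (inl (inl a))).
- by move=> [Dx Ry]; split => //; exact: (@R0_subset_R (inl (inr a))).
Qed.

Lemma G0_D0R0 a x y : G0 a (x, y) -> D0 a x /\ R0 a y.
Proof.
case: a => [[a|a]|a] //= [/= Dx yE]; split => //.
by rewrite yE; apply/mm_f_interior => //; exact: D0_subset_D.
Qed.

Lemma G_in01 a x y : G a (x, y) -> 0 <= x <= 1 /\ 0 <= y <= 1.
Proof.
move=> /G_g[Dx /mm_R_in01 yI _]; split=> //.
have : mm_D a x -> 0 <= x <= 1.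
  have := mm_p_in01 (mm_i_le a).
  case: a {Dx} => [[a|a]|a] /= /andP[p0 p1]; last 2 first.
  - by move=> ->; rewrite p0.
  - by move=> ->; rewrite p0.
  rewrite in_itv /= => /andP[px xp]; rewrite (le_trans p0 px) (le_trans xp) //.
  by case/andP: (mm_p_in01 (mm_i0 a)).
exact.
Qed.

(** Symbols of [A1] and [A2] sit over a point of [P], and the endpoints of [D a] for [a] in [A0] are
    in [P], which leaves only interior points. *)
Lemma G_avoid_P a x y : G a (x, y) -> ~ mm_P F x -> is_A0 a /\ G0 a (x, y).
Proof.
case: a => [[a|a]|a] /= [/= Dx yE] nPx; last 2 first.
- by case: nPx; rewrite Dx; exact/mm_P_p/mm_i1.
- by case: nPx; rewrite Dx; exact/mm_P_p/mm_i2.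
split => //; split => //.
move: Dx; rewrite /= !in_itv /= => /andP[px xp].
rewrite !lt_neqAle px xp !andbT; apply/andP; split; apply/eqP => xE; apply: nPx.
  by rewrite -xE; exact/mm_P_p/ltnW/mm_i0.
by rewrite xE; exact/mm_P_p/mm_i0.
Qed.

Hypothesis hF : properly_parametrized F.

Lemma GF_G0 x y : GF F (x, y) -> exists a, G0 a (x, y).
Proof.
by have [cov _ _] := hF; rewrite -cov => -[a _ G0a]; exists a.
Qed.

Lemma G0_inj a b z : G0 a z -> G0 b z -> a = b.
Proof.
by move=> az bz; have [_ /trivIsetP tr _] := hF; apply/eqP/negPn/negP => ab;
  have /seteqP[/(_ z)+ _] := tr a b I I ab; case.
Qed.

(* A point of [G b] outside [G0 b] has both coordinates in [P], and a symbol [a]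
   whose [G0 a] contains such a point must be in [A2]. *)
Lemma G0_meet_G a b z : G0 a z -> G b z ->
  a = b \/ [/\ is_A2 a, ~~ is_A2 b & G a `<=` G b].
Proof.
case: z => x y az bz.
have [bA2|bNA2] := boolP (is_A2 b).
  by left; apply: G0_inj az _; case: b bA2 bz => [[b|b]|b].
have bP : b = a \/ mm_P F x /\ mm_P F y.
  have bNG0 : G0 b (x, y) \/ mm_P F x /\ mm_P F y.
    case: b bz {bNA2} => [[b|b]|b]; last 2 first.
    - move=> /= [/= Dx Ry]; have [uv RP] := mm_uv1 b.
      have Px : mm_P F x by rewrite Dx; exact/mm_P_p/mm_i1.
      have [Py|nPy] := pselect (mm_P F y); [by right|left; split => //=].
      by rewrite /= in_itv /=; exact: mm_R_avoid_P.
    - by left.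
    move=> bz.
    have [Px|nPx] := pselect (mm_P F x); last first.
      by left; case: (G_avoid_P bz nPx).
    have [/= Dx yE] := bz.
    have [D0x|nD0x] := pselect (D0 (inl (inl b)) x); first by left.
    have Ry : mm_R (inl (inl b)) y by case: (G_g bz).
    right; split=> //; apply: contra_notP nD0x => nPy.
    apply/mm_f_interior => //; rewrite -yE.
    by rewrite /= in_itv /=; exact: mm_R_avoid_P.
  by case: bNG0; [left; apply: G0_inj az|right].
case: bP => [->|[Px Py]]; first by left.
right; have [D0x R0y] := G0_D0R0 az.
case: a az D0x R0y => [[a|a]|a] az D0x R0y.
- move: D0x; rewrite /= in_itv /= => /andP[px xp].
  by have := mm_P_lt Px (mm_i0 a) xp; rewrite leNgt px.
- have [_ RP] := mm_uv1 a.
  have : (mm_R (inl (inr a)) `&` mm_P F) y by split => //; exact: R0_subset_R.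
  move: R0y; rewrite RP /= in_itv /= => /andP[uy yv] [] yE; move: uy yv;
    by rewrite yE ltxx.
split => // -[x' y'] [/= -> Ry'].
by rewrite (mm_R_A2 (a := inr a) isT Ry' R0y) /mm_D -D0x.
Qed.

Lemma exists_GF x : 0 <= x <= 1 -> exists y, GF F (x, y).
Proof.
move=> x01; have : `[0, 1]%classic x by rewrite /= in_itv.
rewrite (mm_cover F) => -[a _ Dx].
suff [y ay] : exists y, G a (x, y) by exists y, a.
case: a Dx => [[a|a]|a] Dx.
- by exists (mm_f a x).
- exists (mm_u (inl (inr a))); split => //=.
  by rewrite /mm_R /= in_itv /= lexx mm_u_le_v.
- exists (mm_u (inr a)); split => //=.
  by rewrite /mm_R /= in_itv /= lexx mm_u_le_v.
Qed.

Lemma R0_neq0 a : R0 a !=set0.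
Proof.
have [_ _ /(_ a I)[[x y] /G0_D0R0[_ ?]]] := hF.
by exists y.
Qed.

(** A point of [R0 a] has a value under [F], and the stratum containing this pair supplies the
    successor. This lets admissible words be extended to points of [Sigma_M]. *)
Lemma exists_M a : exists b, M a b.
Proof.
have [y R0y] := R0_neq0 a.
have [y' /GF_G0[b /G0_D0R0[Dby _]]] := exists_GF (mm_R_in01 (R0_subset_R R0y)).
by exists b; exact: M_of_meet R0y Dby.
Qed.

End letters.

(** * Maximal words *)

Lemma closed_graph_itv (R : realType) (p q : R) (f : R -> R) :
  {within `[p, q], continuous f} ->
  closed [set z : R * R | `[p, q]%classic z.1 /\ z.2 = f z.1].
Proof.
move=> fc; rewrite [X in closed X](_ : _ = (fun x => (x, f x)) @` `[p, q]).
  apply: compact_closed; first exact: norm_hausdorff.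
  apply: continuous_compact; last exact: segment_compact.
  have idc : {within `[p, q], continuous (id : R -> R)}.
    by apply: continuous_subspaceT => x; exact: cvg_id.
  by move=> x; exact: (cvg_pair (idc x) (fc x)).
apply/seteqP; split=> [[x y] /= [xI ->]|z [x xI <-]] //.
by exists x.
Qed.

Lemma closed_setX (T U : topologicalType) (A : set T) (B : set U) :
  closed A -> closed B -> closed (A `*` B).
Proof.
move=> cA cB.
rewrite (_ : A `*` B = (fst @^-1` A) `&` (snd @^-1` B)); last by apply/seteqP; split.
apply: closedI.
  by apply: preimage_closed cA => x _; exact: cvg_fst.
by apply: preimage_closed cB => x _; exact: cvg_snd.
Qed.

Section words.
Variables (R : realType) (F : markov_multimap R).
Implicit Types (a b : alphabet F) (s t : nat -> alphabet F) (x y : nat -> R).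

(** A word of length [n] is stored as the first [n] values of a sequence; it constrains the [n.+1]
    coordinates [x 0, ..., x n]. *)
Definition tracks n s x := forall k, (k < n)%N -> G (s k) (x k, x k.+1).

Definition tracks0 n s x := forall k, (k < n)%N -> G0 (s k) (x k, x k.+1).

Lemma G_closed a : closed (G a).
Proof.
case: a => [[a|a]|a].
- apply: closed_graph_itv; have [_ + _] := mm_homeo a; exact.
- apply: closed_setX; first by rewrite /= -set_itv1; exact: interval_closed.
  exact: interval_closed.
- apply: closed_setX; first by rewrite /= -set_itv1; exact: interval_closed.
  exact: interval_closed.
Qed.

(** A chosen successor map, with arbitrary values outside [C], is iterated from the last symbol of
    the word. *)
Lemma extend_word (C : set (alphabet F)) n s :
  (forall a, C a -> exists2 b, C b & M a b) -> (0 < n)%N ->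
  (forall k, (k < n)%N -> C (s k)) ->
  (forall k, (k.+1 < n)%N -> M (s k) (s k.+1)) ->
  exists2 t, Sigma_M_on F C t & forall k, (k < n)%N -> t k = s k.
Proof.
move=> succ n0 Cs Ms.
have /choice[f fP] : forall a, exists b, C a -> C b /\ M a b.
  move=> a; have [/succ[b Cb Mab]|nCa] := pselect (C a); first by exists b.
  by exists a.
have Cf k : C (iter k f (s n.-1)).
  by elim: k => [|k IH] /=; [apply: Cs; rewrite prednK|have [] := fP _ IH].
exists (fun k => if (k < n)%N then s k else iter (k - n.-1) f (s n.-1)); last first.
  by move=> k ->.
split=> k /=; last by case: ifP => // /Cs.
case: ltnP => kn; case: ltnP => kn'; last 2 first.
- by rewrite ltnNge (leqW kn) in kn'.
- by rewrite subSn ?(leq_trans (leq_pred n)) //; have [] := fP _ (Cf (k - n.-1)%N).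
- exact: Ms.
- have -> : k = n.-1 by lia.
  have -> : (n.-1.+1 - n.-1 = 1)%N by lia.
  by have [] := fP _ (Cf 0%N).
Qed.

Lemma tracks0_M n s x : tracks0 n s x ->
  forall k, (k.+1 < n)%N -> M (s k) (s k.+1).
Proof.
move=> sx k kn; have [_ R0] := G0_D0R0 (sx _ (ltnW kn)).
by have [D0 _] := G0_D0R0 (sx _ kn); exact: M_of_meet R0 D0.
Qed.

Hypothesis hF : properly_parametrized F.

(* Inclusion of the closed graphs [G a] is the closure order of the strata. *)
Definition maximal_word n s := (exists x, tracks0 n s x) /\
  forall t, (exists x, tracks0 n t x) ->
    (forall k, (k < n)%N -> G (s k) `<=` G (t k)) ->
    forall k, (k < n)%N -> t k = s k.

Lemma maximal_word_eq n s t : (forall k, (k < n)%N -> t k = s k) ->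
  maximal_word n s -> maximal_word n t.
Proof.
move=> ts [[x sx] smax]; split; first by exists x => k kn; rewrite ts //; exact: sx.
move=> t' t'x tt' k kn; rewrite ts //; apply: smax => // i iN.
by rewrite -ts //; exact: tt'.
Qed.

(** A point of the nonempty cell [G0 a] lies in [G b]. So a proper inclusion leads from [A2] to
    outside [A2], and the closure order on symbols has chains of at most two elements. *)
Lemma G_subset_eq a b : G a `<=` G b -> a = b \/ is_A2 a /\ ~~ is_A2 b.
Proof.
have [_ _ /(_ a I)[z az]] := hF => ab.
by case: (G0_meet_G hF az (ab _ (G0_subset_G az))) => [|[]]; [left|right].
Qed.

(** Symbols of [A0] have no proper enlargement, so only the first [n] positions matter for
    maximality. *)
Lemma maximal_word_cat m n s : maximal_word n s ->
  (forall k, (n <= k < n + m)%N -> is_A0 (s k)) ->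
  (exists x, tracks0 (n + m) s x) -> maximal_word (n + m) s.
Proof.
move=> [_ smax] sA0 sx; split=> // t [x tx] st k knm.
have [kn|nk] := ltnP k n.
  apply: smax => //.
    by exists x => i iN; apply: tx; rewrite ltn_addr.
  by move=> i iN; apply: st; rewrite ltn_addr.
have := sA0 k; rewrite nk knm => /(_ isT).
by case: (G_subset_eq (st _ knm)) => [->//|[]]; case: (s k) => [[]|].
Qed.

Lemma tracks0_of_trajectory x : trajectories F x ->
  exists s, forall n, tracks0 n s x.
Proof.
move=> [_ xF]; have /choice[s sP] : forall k, exists a, G0 (a : alphabet F) (x k, x k.+1).
  by move=> k; exact: (GF_G0 hF (xF k)).
by exists s => n k _.
Qed.

(** Start from the word of strata visited by [x]. A proper enlargement keeps [x] in the closed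
    graphs and lowers the number of symbols in [A2], so enlarging stops. *)
Lemma exists_maximal_word n x : trajectories F x ->
  exists2 s, maximal_word n s & tracks n s x.
Proof.
move=> /tracks0_of_trajectory[s /(_ n) sx].
have : exists x, tracks0 n s x by exists x.
have : tracks n s x by move=> k /sx /G0_subset_G.
pose cnt s := (\sum_(i < n) is_A2 (s i))%N.
have [c] := ubnP (cnt s); elim: c s {sx} => // c IH s; rewrite ltnS => sc sx s0.
have [smax|nmax] := pselect (maximal_word n s); first by exists s.
have [t [t0 st [k kn tk]]] : exists t, [/\ exists x, tracks0 n t x,
    forall k, (k < n)%N -> G (s k) `<=` G (t k) & exists2 k, (k < n)%N & t k <> s k].
  apply: contra_notP nmax => nt; split=> // t t0 st k kn.
  by apply: contra_notP nt => tk; exists t; split => //; exists k.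
apply: (IH t) => //; last by move=> i iN; apply: st => //; exact: sx.
apply: leq_trans sc; rewrite /cnt (bigD1 (Ordinal kn)) //=.
rewrite [X in (_ < X)%N](bigD1 (Ordinal kn)) //=.
case: (G_subset_eq (st _ kn)) => [/esym//|[-> /negbTE->]].
rewrite add0n add1n ltnS; apply: leq_sum => i _.
by case: (G_subset_eq (st i (ltn_ord i))) => [->//|[-> _]]; rewrite leq_b1.
Qed.

(** The stratum of [s] is the complement in [X_(n+1)] of the sets [C v] for the other words [v] with
    nonempty stratum. These sets are closed and finite in number. *)
Lemma maximal_word_essential n s : (0 < n)%N -> maximal_word n s ->
  essential_word [tuple s i | i < n].
Proof.
move=> n0 [[x0 sx0] smax]; split.
  have [||t [tM _] ts] := @extend_word setT n s _ n0 _ (tracks0_M sx0) => //.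
    by move=> a _; have [b Mab] := exists_M hF a; exists b.
  exists t => //; exists 0%N; apply: (@eq_from_nth _ (s 0%N)).
    by rewrite size_tuple size_mkseq.
  move=> i; rewrite size_tuple => iN.
  by rewrite nth_mkseq // add0n ts // -[i]/(val (Ordinal iN)) -tnth_nth tnth_mktuple.
pose C (v : n.-tuple (alphabet F)) : set 'rV[R]_n.+1 :=
  [set x | forall k : 'I_n, G (tnth v k)
     (x ord0 (widen_ord (leqnSn n) k), x ord0 (lift ord0 k))].
have Ccl v : closed (C v).
  rewrite (_ : C v = \bigcap_(k in setT) (fun x : 'rV[R]_n.+1 =>
     (x ord0 (widen_ord (leqnSn n) k), x ord0 (lift ord0 k))) @^-1` G (tnth v k)).
    apply: closed_bigI => k _; apply: preimage_closed (@G_closed _) => x _.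
    exact: (cvg_pair (@coord_continuous _ _ _ _ _ x) (@coord_continuous _ _ _ _ _ x)).
  by apply/seteqP; split => [x Cx k _|x Cx k]; exact: Cx.
pose fn (v : n.-tuple (alphabet F)) k := nth (s 0%N) v k.
pose fx (x : 'rV[R]_n.+1) k := x ord0 (inord k).
have fnE v (k : 'I_n) : fn v k = tnth v k by rewrite (tnth_nth (s 0%N)).
have fxE (x : 'rV[R]_n.+1) (k : 'I_n) : fx x k = x ord0 (widen_ord (leqnSn n) k).
  by congr (x _ _); apply: val_inj; rewrite /= inordK // ltnS ltnW.
have fxSE (x : 'rV[R]_n.+1) (k : 'I_n) : fx x k.+1 = x ord0 (lift ord0 k).
  by congr (x _ _); apply: val_inj; rewrite /= inordK // ltnS.
pose B := [set v | (exists x, tracks0 n (fn v) x) /\ v <> [tuple s i | i < n]].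
apply/open_subspaceP; exists (~` \bigcup_(v in B) C v).
  by rewrite openC; apply: closed_bigcup => [|v _]; [exact: finite_finset|exact: Ccl].
apply/seteqP; split=> [x [xB xX]|x [[xX xs] _]]; split => //; last first.
  (* A point of the stratum of [s] lying in [C v] gives [G (s k) <= G (v k)] for every [k], so [v]
     is [s] by maximality. *)
  move=> [v [vx vs] Cv]; apply: vs; apply: eq_from_tnth => k.
  rewrite tnth_mktuple -fnE; apply: smax => // i iN.
  have := xs (Ordinal iN); have := Cv (Ordinal iN).
  rewrite tnth_mktuple -fnE /= => vG sG0.
  by case: (G0_meet_G hF sG0 vG) => [->//|[]].
split => //.
(* Conversely, the word [f] of the stratum containing [x] must be [s], since otherwise [x] would lie
   in the removed set [C f]. *)
have /choice[f fP] : forall k : 'I_n, exists a : alphabet F,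
    G0 a (x ord0 (widen_ord (leqnSn n) k), x ord0 (lift ord0 k)).
  by move=> k; apply: (GF_G0 hF); have [_] := xX; apply; rewrite /= /bump.
have [E|nE] := pselect ([tuple f i | i < n] = [tuple s i | i < n]).
  by move=> k; rewrite -E tnth_mktuple.
exfalso; apply: xB; exists [tuple f i | i < n].
  split=> //; exists (fx x) => k kn.
  rewrite -[k]/(val (Ordinal kn)) fnE fxE fxSE tnth_mktuple; exact: fP.
by move=> k; rewrite tnth_mktuple; apply: G0_subset_G.
Qed.

Lemma maximal_word_subset (C : set (alphabet F)) n s :
  essential_symbols F `<=` C -> maximal_word n s ->
  forall k, (k < n)%N -> C (s k).
Proof.
move=> eC smax k kn; apply: eC; exists n, [tuple s i | i < n].
split; first by apply: maximal_word_essential => //; exact: leq_ltn_trans kn.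
by apply/tnthP; exists (Ordinal kn); rewrite tnth_mktuple.
Qed.

End words.

(** * Gluing and periodic orbits *)

Lemma within_continuous_comp_subset (T U V : topologicalType) (A : set T)
    (B : set U) (f : T -> U) (h : U -> V) :
  (forall x, A x -> B (f x)) -> {within A, continuous f} ->
  {within B, continuous h} -> {within A, continuous (h \o f)}.
Proof.
move=> AB /subspace_continuousP fc /subspace_continuousP hc.
apply/subspace_continuousP => x Ax W /= /(hc _ (AB _ Ax)).
rewrite /= !nbhs_simpl /= /within /= => hW.
have := fc _ Ax _ hW; rewrite /= !nbhs_simpl /= /within /=.
by apply: filterS => y Py Ay; apply: Py => //; exact: AB.
Qed.

Lemma itv_fixed_point (R : realType) (u v : R) (h : R -> R) : u <= v ->
  {within `[u, v], continuous h} -> (forall x, u <= x <= v -> u <= h x <= v) ->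
  exists2 x, u <= x <= v & h x = x.
Proof.
move=> uv hc hI.
have idc : {within `[u, v], continuous (id : R -> R)}.
  by apply: continuous_subspaceT => x; exact: cvg_id.
have /andP[hu _] : u <= h u <= v by apply: hI; rewrite lexx.
have /andP[_ hv] : u <= h v <= v by apply: hI; rewrite lexx uv.
have [|x xI /eqP] := IVT (v := 0) uv (within_continuousB hc idc).
  rewrite ge_min le_max; apply/andP; split; apply/orP; [right|left].
    by rewrite subr_le0.
  by rewrite subr_ge0.
by rewrite subr_eq0 => /eqP hx; exists x; [move: xI; rewrite in_itv|].
Qed.

(** Induction on a list of the points to avoid: if the next one lies inside the interval, it becomes
    the new right endpoint. *)
Lemma finite_set_avoid (R : realFieldType) (E : set R) (u v : R) :
  finite_set E -> u < v -> exists2 y, u < y < v & ~ E y.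
Proof.
move=> /finite_seqP[s ->]; elim: s v => [|a s IH] v uv.
  by exists ((u + v) / 2) => //; apply/andP; split; lra.
have [av|nav] := boolP (u < a < v).
  have /andP[ua va] := av; have [y /andP[uy ya] ys] := IH _ ua.
  exists y; first by rewrite uy (lt_trans ya).
  by rewrite /= inE => /orP[/eqP yE|//]; rewrite yE ltxx in ya.
have [y uyv ys] := IH _ uv; exists y => //=; rewrite inE => /orP[/eqP yE|//].
by rewrite -yE uyv in nav.
Qed.

Lemma mkseqS_shift (T : Type) (s : nat -> T) n :
  mkseq s n.+1 = s 0%N :: mkseq (left_shift s) n.
Proof. by rewrite /mkseq /= -[1%N]addn0 iotaDl -map_comp. Qed.

Section dynamics.
Variables (R : realType) (F : markov_multimap R).
Implicit Types (a b : alphabet F) (s t : nat -> alphabet F) (x y z : nat -> R).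

Lemma g_word_dom_mkseq s n : g_word_dom F (mkseq s n.+1) = mm_R (s n).
Proof.
rewrite mkseqS_shift /g_word_dom; congr mm_R.
rewrite -[RHS](nth_mkseq (s 0%N) s (ltnSn n)) -nth_last size_mkseq.
by rewrite mkseqS_shift; case: n.
Qed.

Lemma tracks_g_word n s x : tracks n s x ->
  x 0%N = g_word F (mkseq s n) (x n).
Proof.
elim: n s x => [//|n IH] s x sx.
have [_ _ ->] := G_g (sx 0%N isT).
rewrite mkseqS_shift [RHS]/=; congr (g _ _).
by apply: (IH _ (left_shift x)) => k kn; exact: sx.
Qed.

Lemma tracks_dom n s x : tracks n.+1 s x -> mm_R (s n) (x n.+1).
Proof. by move=> /(_ _ (ltnSn n)) /G_g[]. Qed.

(** The orbit is built backwards from [r] by the maps [g (s k)]; the condition [M] keeps each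
    preimage in the range of the preceding symbol. *)
Lemma exists_tracks n s (r : R) :
  (forall k, (k < n)%N -> M (s k) (s k.+1)) -> mm_R (s n) r ->
  exists z, [/\ tracks n.+1 s z, z n.+1 = r & R0 (s n) r -> tracks0 n.+1 s z].
Proof.
elim: n s => [|n IH] s Ms Rr.
  exists (fun k => if k is 0%N then g (s 0%N) r else r); split => //.
    by case=> // _; exact: g_G.
  by move=> R0r; case=> // _; exact: g_G0.
have [|z [sz zr sz0]] := IH (left_shift s) _ Rr; first by move=> k kn; exact: Ms.
have M0 := Ms 0%N isT.
have Rz : mm_R (s 0%N) (z 0%N).
  by have [Dz _ _] := G_g (sz 0%N isT); exact: M_D_subset_R M0 _ Dz.
exists (fun k => if k is j.+1 then z j else g (s 0%N) (z 0%N)); split => //.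
  by case=> [_|k kn]; [exact: g_G|exact: sz].
move=> R0r; case=> [_|k kn]; last exact: sz0.
have [D0z _] := G0_D0R0 (sz0 R0r 0%N isT).
by apply: g_G0; exact: M0.
Qed.

Lemma g_continuous a : {within mm_R a, continuous (g a)}.
Proof.
case: a => [[a|a]|a]; last 2 first.
- by apply: continuous_subspaceT => x; exact: cvg_cst.
- by apply: continuous_subspaceT => x; exact: cvg_cst.
by have [_ _] := mm_homeo a.
Qed.

Lemma g_word_continuous n s : (forall k, (k < n)%N -> M (s k) (s k.+1)) ->
  {within mm_R (s n), continuous (g_word F (mkseq s n.+1))}.
Proof.
elim: n s => [|n IH] s Ms; rewrite mkseqS_shift; first exact: g_continuous.
have Ms' k : (k < n)%N -> M (left_shift s k) (left_shift s k.+1).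
  by move=> kn; exact: Ms.
apply: (within_continuous_comp_subset _ (IH _ Ms') (@g_continuous _)) => r Rr.
have [z [sz zr _]] := exists_tracks Ms' Rr.
rewrite -zr -(tracks_g_word sz); have [Dz _ _] := G_g (sz 0%N isT).
exact: (M_D_subset_R (Ms 0%N isT)).
Qed.

Lemma periodic_orbit p (c : nat -> alphabet F) : (0 < p)%N -> Sigma_M F c ->
  (forall k, c (k + p)%N = c k) ->
  exists z, (forall k, z (k + p)%N = z k) /\ forall k, G (c k) (z k, z k.+1).
Proof.
case: p => // p _ cM cp.
have Mc k : (k < p)%N -> M (c k) (c k.+1) by move=> _; exact: cM.
have hI r : mm_R (c p) r -> mm_R (c p) (g_word F (mkseq c p.+1) r).
  move=> Rr; have [z [cz zr _]] := exists_tracks Mc Rr.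
  rewrite -zr -(tracks_g_word cz); have [Dz _ _] := G_g (cz 0%N isT).
  (* The period is now [p.+1], so [c p] is followed by [c 0], and the image, lying in [D (c 0)],
     returns to [R (c p)]. *)
  by have := cM p; rewrite -[p.+1]add0n cp => /M_D_subset_R; exact.
have [|r rI hr] := itv_fixed_point (mm_u_le_v (c p)) (g_word_continuous Mc).
  by move=> r rI; have := hI r; rewrite /mm_R /= !in_itv /=; exact.
have Rr : mm_R (c p) r by rewrite /mm_R /= in_itv.
have [z [cz zr _]] := exists_tracks Mc Rr.
have z0 : z 0%N = z p.+1 by rewrite (tracks_g_word cz) zr hr.
have cmod k : c k = c (k %% p.+1)%N.
  rewrite {1}(divn_eq k p.+1); elim: (k %/ p.+1)%N => [//|q IH].
  by rewrite mulSn -addnA addnC cp.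
(* Repeating the first [p.+1] points is consistent at the seam because [z p.+1 = z 0]. *)
exists (fun k => z (k %% p.+1)%N); split => k; first by rewrite modnDr.
rewrite cmod; have := cz (k %% p.+1)%N (ltn_pmod k (ltn0Sn p)).
suff -> : z (k %% p.+1).+1 = z (k.+1 %% p.+1)%N by [].
rewrite -[k.+1]addn1 -modnDml addn1.
have := ltn_pmod k (ltn0Sn p); rewrite leq_eqVlt => /orP[/eqP ->|kp].
  by rewrite modnn z0.
by rewrite [(_.+1 %% _)%N]modn_small.
Qed.

Lemma tracks_trajectories (c : nat -> alphabet F) z :
  (forall k, G (c k) (z k, z k.+1)) -> trajectories F z.
Proof.
move=> cz; split=> k; last by exists (c k).
by have [] := G_in01 (cz k); rewrite /= in_itv.
Qed.

Section mixing.
Variable C : set (alphabet F).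

Lemma Sigma_M_on_shift s k : Sigma_M_on F C s ->
  Sigma_M_on F C (fun i => s (k + i)%N).
Proof. by move=> [sM sC]; split=> i /=; [rewrite addnS; exact: sM|exact: sC]. Qed.

Lemma mixing_path : mixing F C -> exists2 N, (0 < N)%N &
  forall a b, C a -> C b -> forall n, (N <= n)%N ->
    exists t, [/\ Sigma_M_on F C t, t 0%N = a & t n = b].
Proof.
move=> [N N0 CN]; exists N => // a b Ca Cb n Nn.
(* A path of [n] transitions is a word of length [n.+1]. *)
have [w [t tM [k wE]] wb] := CN a b Ca Cb n.+1 (leqW Nn).
exists (fun i => t (k + i)%N); split; first exact: Sigma_M_on_shift.
  by have := congr1 (nth a ^~ 0%N) wE; rewrite /= => <-.
have := congr1 (nth a ^~ n) wE; rewrite nth_mkseq // => <-; rewrite -wb.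
rewrite (last_nth a); congr nth.
by have := congr1 size wE; rewrite size_mkseq => -[].
Qed.

Definition splice n s t : nat -> alphabet F :=
  fun k => if (k < n)%N then s k else t (k - n)%N.

Lemma splice_le n s t k : s n = t 0%N -> (k <= n)%N -> splice n s t k = s k.
Proof.
by rewrite /splice leq_eqVlt => st /orP[/eqP ->|->//]; rewrite ltnn subnn.
Qed.

Lemma splice_ge n s t k : splice n s t (n + k) = t k.
Proof. by rewrite /splice ltnNge leq_addr addKn. Qed.

(** As the two sequences share the symbol at position [n], the transition into it is read in [s] and
    the one out of it in [t]. *)
Lemma splice_Sigma_M_on n s t : s n = t 0%N ->
  Sigma_M_on F C s -> Sigma_M_on F C t -> Sigma_M_on F C (splice n s t).
Proof.
move=> st [sM sC] [tM tC]; split=> k /=; last by rewrite /splice; case: ifP.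
have [kn|nk] := ltnP k n.
  by rewrite !splice_le ?(ltnW kn) //; exact: sM.
by rewrite -(subnKC nk) -addnS !splice_ge; exact: tM.
Qed.

(** Induction on the number of blocks, block [k] occupying times [a k] to [a k + L k]. Time is
    counted from [a 1]; the two inequalities in the conclusion keep the subtractions from
    truncating. *)
Lemma glue_words N (s : nat -> nat -> alphabet F) (a L : nat -> nat) l :
  (forall a b, C a -> C b -> forall n, (N <= n)%N ->
    exists t, [/\ Sigma_M_on F C t, t 0%N = a & t n = b]) ->
  (forall k, (1 <= k <= l.+1)%N -> Sigma_M_on F C (s k)) ->
  (forall k, (1 <= k < l.+1)%N -> (a k + L k + N <= a k.+1)%N) ->
  exists2 t, Sigma_M_on F C t & forall k, (1 <= k <= l.+1)%N ->
    (a 1 <= a k)%N /\ (a k + L k <= a l.+1 + L l.+1)%N /\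
    forall i, (i <= L k)%N -> t (a k + i - a 1)%N = s k i.
Proof.
move=> CN; elim: l => [|l IH] sC aL.
  exists (s 1%N); first exact: sC.
  move=> k kl; have -> : k = 1%N by lia.
  by do 2![split=> //] => i _; rewrite addKn.
have [||t tC tP] := IH.
- by move=> k kl; apply: sC; lia.
- by move=> k kl; apply: aL; lia.
have [a1 [_ tl]] := tP l.+1 ltac:(lia); have aLl := aL l.+1 ltac:(lia).
have sC' : Sigma_M_on F C (s l.+2) by apply: sC; lia.
have sCl : Sigma_M_on F C (s l.+1) by apply: sC; lia.
have [w [wC w0 wn]] := CN (s l.+1 (L l.+1)) (s l.+2 0%N) (sCl.2 _) (sC'.2 _)
  (a l.+2 - a l.+1 - L l.+1)%N ltac:(lia).
set n := (a l.+2 - a l.+1 - L l.+1)%N in wn.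
(* Position in [t] of the last symbol of block [l.+1], where the connecting path [w] of [n]
   transitions begins. *)
set q := (a l.+1 + L l.+1 - a 1%N)%N.
have wsC := splice_Sigma_M_on wn wC sC'.
have tw : t q = splice n w (s l.+2) 0%N by rewrite splice_le // tl.
exists (splice q t (splice n w (s l.+2))); first exact: splice_Sigma_M_on.
move=> k kl; have [->|kl'] := eqVneq k l.+2.
  split; first by lia.
  split=> // i iL; have -> : (a l.+2 + i - a 1 = q + (n + i))%N by lia.
  by rewrite !splice_ge.
have [ak [akl tk]] := tP k ltac:(lia); split=> //.
split=> [|i iL]; first by lia.
by rewrite splice_le ?tk //; lia.
Qed.

Lemma glue_words_periodic : mixing F C -> exists N, forall l
    (s : nat -> nat -> alphabet F) (a L : nat -> nat), (1 <= l)%N ->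
  (forall k, (1 <= k <= l)%N -> Sigma_M_on F C (s k)) ->
  (forall k, (1 <= k < l)%N -> (a k + L k + N <= a k.+1)%N) ->
  forall p, (a l + L l + N <= a 1 + p)%N ->
  exists c, [/\ Sigma_M_on F C c, forall k, c (k + p)%N = c k &
    forall k, (1 <= k <= l)%N -> forall i, (i <= L k)%N -> c (a k + i)%N = s k i].
Proof.
move=> /mixing_path[N N0 CN]; exists N => -[//|l] s a L _ sC aL p pL.
have [t tC tP] := glue_words CN sC aL.
have [_ [_ t1]] := tP 1%N ltac:(lia); have [a1 [_ tl]] := tP l.+1 ltac:(lia).
have sC1 : Sigma_M_on F C (s 1%N) by apply: sC; lia.
have sCl : Sigma_M_on F C (s l.+1) by apply: sC; lia.
set q := (a l.+1 + L l.+1 - a 1%N)%N.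
(* A last connecting path leads from the end of the final block back to the first symbol of block 1,
   for a total length of [p]. *)
have [w [wC w0 wp]] := CN (s l.+1 (L l.+1)) (s 1%N 0%N) (sCl.2 _) (sC1.2 _)
  (p - q)%N ltac:(lia).
have tw : t q = w 0%N by rewrite tl.
have [dM dC] := splice_Sigma_M_on tw tC wC; set d := splice q t w in dM dC.
have dp : d p = d 0%N.
  have -> : p = (q + (p - q))%N by lia.
  rewrite {1}/d splice_ge wp /d splice_le //.
  by have := t1 0%N isT; rewrite addn0 subnn.
have p0 : (0 < p)%N by lia.
(* Time is shifted back by [a 1]; the multiple [a 1 * p] of the period prevents truncation without
   changing the residue. *)
exists (fun k => d ((k + a 1%N * p - a 1%N) %% p)%N); split.
- split=> k /=; last exact: dC.
  set j := (k + a 1%N * p - a 1%N)%N.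
  have -> : (k.+1 + a 1%N * p - a 1%N = j + 1)%N by rewrite /j; nia.
  rewrite -modnDml addn1; have := ltn_pmod j p0.
  rewrite leq_eqVlt => /orP[/eqP jp|jp]; last by rewrite [(_.+1 %% _)%N]modn_small.
  by rewrite jp modnn -dp -{2}jp; exact: dM.
- by move=> k; rewrite addnAC -addnBAC ?modnDr //; nia.
- move=> k kl i iL; have [ak [akl tk]] := tP k kl.
  have -> : (a k + i + a 1%N * p - a 1%N = a 1%N * p + (a k + i - a 1%N))%N by nia.
  by rewrite modnMDl modn_small /d ?splice_le ?tk //; lia.
Qed.

End mixing.

End dynamics.

(** * Shadowing and specification *)

Lemma dist_le_ell (R : realType) (J : set R) x y :
  J `<=` `[0, 1] -> J x -> J y -> `|x - y| <= ell J.
Proof.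
move=> J01.
have supJ z : J z -> z <= sup J.
  by apply: ub_le_sup; exists 1 => t /J01; rewrite /= in_itv => /andP[].
have infJ z : J z -> inf J <= z.
  by apply: ge_inf; exists 0 => t /J01; rewrite /= in_itv => /andP[].
move=> Jx Jy; rewrite /ell ler_norml.
have := supJ _ Jx; have := supJ _ Jy; have := infJ _ Jx; have := infJ _ Jy.
by move=> ? ? ? ?; apply/andP; split; lra.
Qed.

Section shadowing.
Variables (R : realType) (F : markov_multimap R).
Implicit Types (a b : alphabet F) (s t : nat -> alphabet F) (x y z : nat -> R).

(** If [t] codes a trajectory from [r], both [r] and [z 0] lie in [I_u] for the prefix [u] of [t] of
    length [m]. Part (ii) of (CC) makes [m] independent of [r]. *)
Lemma coding_contraction (delta : R) : coding_condition F -> 0 < delta ->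
  exists m, forall r, 0 <= r <= 1 -> exists t x,
    [/\ trajectories F x, x 0%N = r, tracks m t x &
      forall z, tracks m t z -> `|z 0%N - r| < delta].
Proof.
move=> [Z [[ZM _ _] _ Zcov /cvgrPdist_lt Zell]] delta0.
(* Length [n.+1] rules out the empty word, whose domain is empty. *)
have [n _ /(_ n.+1 (leqnSn n)) Zn] := Zell _ delta0.
exists n.+1 => r r01.
have [|t [x [Zt xX x0 tx]]] := Zcov r; first by rewrite /= in_itv.
have txn : tracks n.+1 t x by move=> k _; exact: tx.
exists t, x; split => // z tz; rewrite -x0.
have Jz y : tracks n.+1 t y -> I_word (mkseq t n.+1) (y 0%N).
  move=> ty; exists (y n.+1); last by rewrite (tracks_g_word ty).
  by rewrite g_word_dom_mkseq; exact: tracks_dom.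
have J01 : I_word (mkseq t n.+1) `<=` `[0, 1].
  move=> _ [q + <-]; rewrite g_word_dom_mkseq => Rq.
  have [y [ty yq _]] := exists_tracks (fun k _ => ZM _ Zt k) Rq.
  by rewrite -yq -(tracks_g_word ty) /= in_itv; have [] := G_in01 (ty 0%N isT).
apply: le_lt_trans (dist_le_ell J01 (Jz _ tz) (Jz _ txn)) _.
move: Zn; rewrite /= sub0r normrN; apply: le_lt_trans; apply: le_trans (ler_norm _).
have sz : size (mkseq t n.+1) == n.+1 by rewrite size_mkseq.
apply: (@le_bigmax_cond _ _ _ _ (Tuple sz) _
  (fun u : n.+1.-tuple (alphabet F) => ell (I_word u))).
by apply/asboolP; exists t => //; exists 0%N.
Qed.

(** A finite set containing every point that [F] can send into the finite set [E], as [G a]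
    determines [x = g a y]. Adding [P] at each stage makes the [m]-th iterate record visits to [P]
    at all times up to [m]. *)
Definition multimap_preimage (E : set R) : set R :=
  mm_P F `|` \bigcup_(a : alphabet F) (g a @` E).

Lemma finite_iter_preimage m : finite_set (iter m multimap_preimage (mm_P F)).
Proof.
elim: m => [|m IH]; first exact: finite_mm_P.
rewrite iterS /multimap_preimage finite_setU; split; first exact: finite_mm_P.
by apply: bigcup_finite => [|a _]; [exact: finite_finset|exact: finite_image].
Qed.

Lemma trajectory_avoids_P m x : trajectories F x ->
  ~ iter m multimap_preimage (mm_P F) (x 0%N) ->
  forall k, (k <= m)%N -> ~ mm_P F (x k).
Proof.
elim: m x => [|m IH] x [x01 xF] nEx k; first by rewrite leqn0 => /eqP ->.
case: k => [_ Px|k kn]; first by apply: nEx; left.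
apply: (IH (left_shift x)) => //.
  by split=> i; [exact: x01|exact: xF].
move=> Ex; apply: nEx; right.
have [a _ /G_g[_ _ ->]] := xF 0%N.
by exists a => //; exists (x 1%N).
Qed.

Hypothesis hF : properly_parametrized F.

(* If the last symbol [v n] of the maximal word [v] is in [A2], then [z n.+1] is
   determined by it.  Otherwise [R0 (v n)] is an open interval, in which a
   generic [r] is chosen. *)
Lemma shadowing (C : set (alphabet F)) (delta : R) :
  coding_condition F -> essential_symbols F `<=` C ->
  (forall a, C a -> exists2 b, C b & M a b) -> 0 < delta ->
  exists m, forall x n, trajectories F x -> exists s,
    [/\ Sigma_M_on F C s, tracks n.+1 s x &
      forall z, tracks (n.+1 + m) s z -> `|z n.+1 - x n.+1| < delta].
Proof.
move=> hCC eC succ delta0.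
have [|m mP] := @coding_contraction (delta / 2) hCC; first by rewrite divr_gt0.
exists m => x n xX; have [v vmax vx] := exists_maximal_word hF n.+1 xX.
have [[x0 vx0] _] := vmax.
have Rx := tracks_dom vx.
have [vA2|vNA2] := boolP (is_A2 (v n)).
  have [s sC sv] := extend_word succ (ltn0Sn n)
    (maximal_word_subset hF eC vmax) (tracks0_M vx0).
  exists s; split => // [k kn|z sz]; first by rewrite sv //; exact: vx.
  have [] := G_g (sz n (leq_addr m n.+1)); rewrite sv // => _ Rz _.
  by rewrite (mm_R_A2 vA2 Rz Rx) subrr normr0.
have uv : mm_u (v n) < mm_v (v n).
  case: (v n) vNA2 => [[a|a]|a] // _; first exact: mm_uv0.
  by case: (mm_uv1 a).
move: Rx; rewrite /mm_R /= in_itv /= => /andP[ux xv].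
(* The generic endpoint [r] stays within [delta / 2] of [x n.+1]; the contraction around [r] uses up
   the other half. *)
have [r /andP[rl ru] nEr] : exists2 r,
    Num.max (mm_u (v n)) (x n.+1 - delta / 2) < r <
    Num.min (mm_v (v n)) (x n.+1 + delta / 2) &
    ~ iter m multimap_preimage (mm_P F) r.
  apply: finite_set_avoid; first exact: finite_iter_preimage.
  by rewrite gt_max !lt_min uv /=; apply/and3P; split; lra.
move: rl ru; rewrite gt_max lt_min => /andP[ur xr] /andP[rv rx].
have R0r : R0 (v n) r.
  by case: (v n) vNA2 ur rv => [[a|a]|a] //= _ ur rv; rewrite in_itv /= ur.
have [t [y [yX y0 ty tz]]] := mP r (mm_R_in01 (R0_subset_R R0r)).
rewrite -y0 in nEr; have yP := trajectory_avoids_P yX nEr.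
have [w [_ wr w0]] := exists_tracks (tracks0_M vx0) (R0_subset_R R0r).
pose s := splice n.+1 v t.
(* The orbit [w] through the open strata of [v] ends at [r], where the trajectory [y], which avoids
   [P], takes over. *)
have sw : tracks0 (n.+1 + m) s (fun k => if (k < n.+1)%N then w k else y (k - n.+1)%N).
  move=> k knm; rewrite /s /splice; have [kn|nk] := ltnP k n.+1.
    have := w0 R0r k kn; case: ltnP => // nk.
    have -> : k = n by lia.
    by rewrite subnn y0 -wr.
  rewrite ltnNge (leqW nk) /= subSn //.
  have km : (k - n.+1 < m)%N by lia.
  by case: (G_avoid_P (ty _ km) (yP _ (ltnW km))).
have smax : maximal_word (n.+1 + m) s.
  apply: maximal_word_cat => //; last by eexists; exact: sw.
    by apply: maximal_word_eq vmax => k kn; rewrite /s /splice kn.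
  move=> k /andP[nk knm]; rewrite /s /splice ltnNge nk /=.
  have km : (k - n.+1 < m)%N by lia.
  by case: (G_avoid_P (ty _ km) (yP _ (ltnW km))).
have [s' s'C s's] := extend_word succ (ltn_addr _ (ltn0Sn n))
    (maximal_word_subset hF eC smax) (tracks0_M sw).
exists s'; split => // [k kn|z sz].
  by rewrite s's ?ltn_addr // /s /splice kn; exact: vx.
have := tz (fun k => z (n.+1 + k)%N); rewrite addn0 => zr.
have {zr} : `|z n.+1 - r| < delta / 2.
  apply: zr => k km; have := sz (n.+1 + k)%N; rewrite ltn_add2l => /(_ km).
  by rewrite s's ?ltn_add2l // /s splice_ge addnS.
by rewrite !ltr_norml => /andP[? ?]; apply/andP; split; lra.
Qed.

End shadowing.

Lemma iter_left_shift (S : Type) i (x : nat -> S) :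
  iter i (@left_shift S) x = fun k => x (k + i)%N.
Proof.
elim: i => [|i IH]; apply/funext => k; first by rewrite addn0.
by rewrite iterS IH /left_shift addSnnS.
Qed.

(** Coordinates beyond [K] contribute at most [1 / (k + 1) < eps / 2]. The half absorbs the loss of
    strictness in passing to the supremum. *)
Lemma traj_dist_lt (R : realType) (eps : R) : 0 < eps -> exists K, forall x y,
  (forall k, 0 <= x k <= 1) -> (forall k, 0 <= y k <= 1) ->
  (forall k, (k <= K)%N -> `|x k - y k| < eps / 2) -> traj_dist x y < eps.
Proof.
move=> eps0; have eps20 : 0 < eps / 2 by rewrite divr_gt0.
have [K KP] : exists K : nat, (eps / 2)^-1 < K.+1%:R.
  exists (Num.truncn (eps / 2)^-1); apply: truncnS_gt.
exists K => x y x01 y01 xy; apply: (@le_lt_trans _ _ (eps / 2)); last by lra.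
apply: ge_sup; first by eexists; exists 0%N.
move=> _ [k _ <-]; rewrite ler_pdivrMr ?ltr0Sn //.
have [kK|Kk] := leqP k K.
  apply: le_trans (ltW (xy k kK)) _.
  by rewrite ler_peMr ?ler1n // ltW.
apply: (@le_trans _ _ 1).
  have /andP[? ?] := x01 k; have /andP[? ?] := y01 k.
  by rewrite ler_norml; apply/andP; split; lra.
rewrite -ler_pdivrMl // mulr1 (le_trans (ltW KP)) // ler_nat.
exact: leqW.
Qed.

Theorem theorem6p1 (R : realType) (F : markov_multimap R)
    (hF : properly_parametrized F)
    (hCC : coding_condition F) (hMC : mixing_condition F)
    (C0 : set (alphabet F))
    (hC0 : mixing_component F C0) (hess : essential_symbols F `<=` C0)
    (hequi : uniformly_equicontinuous (words (Sigma_M_on F C0))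
               (g_word_dom F) (g_word F)) :
  specification (trajectories F) (@traj_dist R) (@left_shift R).
Proof.
have [C0mix _] := hC0.
have succ a : C0 a -> exists2 b, C0 b & M a b.
  have [N _ CN] := mixing_path C0mix => C0a.
  have [t [[tM tC] t0 _]] := CN a a C0a C0a N (leqnn N).
  by exists (t 1%N); [exact: tC|rewrite -t0; exact: tM].
move=> eps eps0; have [K KP] := traj_dist_lt eps0.
have [|delta delta0 deltaP] := hequi (eps / 2); first by rewrite divr_gt0.
have [m mP] := shadowing hF hCC hess succ delta0.
have [N NP] := glue_words_periodic C0mix.
(* [K] further coordinates are seen by the metric, [m] symbols force closeness at the endpoint, [N]
   is the mixing gap, and 1 accounts for the endpoint [b k + K + 1]. *)
exists (K + m + N + 1)%N => l x a b l1 xX ab abN p pN.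
have [s0 _] := mP (x 1%N) 0%N (xX 1%N l1).
have /choice[s sP] : forall k, exists s, (1 <= k <= l)%N ->
    [/\ Sigma_M_on F C0 s, tracks (b k + K - a k).+1 s (fun i => x k (a k + i)%N) &
      forall z, tracks ((b k + K - a k).+1 + m) s z ->
        `|z (b k + K - a k).+1 - x k (a k + (b k + K - a k).+1)%N| < delta].
  move=> k; have [kl|nkl] := boolP (1 <= k <= l)%N; last by exists s0.
  have [|s sP] := mP (fun i => x k (a k + i)%N) (b k + K - a k)%N; last by exists s.
  have [x01 xF] := xX k kl.
  by split=> i; [exact: x01|rewrite addnS; exact: xF].
have [|||c [[cM cC] cp cs]] := NP l s a (fun k => (b k + K - a k).+1 + m)%N l1 _ _ p _.
- by move=> k kl; have [] := sP k kl.
- by move=> k kl; have := abN k kl; have := ab k; lia.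
- by have := ab 1%N; have := ab l; lia.
have [|z [zp zc]] := periodic_orbit _ cM cp; first by lia.
have zX := tracks_trajectories zc.
exists z; split=> //.
  by rewrite iter_left_shift; apply/funext => k; exact: zp.
move=> k kl i iab; have [_ sx sz] := sP k kl; have abk := ab k kl.
have zn : `|z (a k + (b k + K - a k).+1)%N - x k (a k + (b k + K - a k).+1)%N| < delta.
  apply: (sz (fun i => z (a k + i)%N)) => j jn.
  by rewrite -(cs k kl) ?addnS; [exact: zc|lia].
rewrite !iter_left_shift; apply: KP => j.
- by have [z01 _] := zX; have := z01 (j + i)%N; rewrite /= in_itv.
- by have [x01 _] := xX k kl; have := x01 (j + i)%N; rewrite /= in_itv.
(* Time [j + i] is [q] steps after [a k] and [n.+1] steps before the endpoint. Both orbits at that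
   time are images of their endpoints under the same [g_u] with [u] in [L(C0)], so equicontinuity
   applies. *)
move=> jK; pose q := (j + i - a k)%N; pose n := (b k + K - a k - q)%N.
have -> : (j + i = a k + q)%N by rewrite /q; lia.
have qn : ((b k + K - a k).+1 = q + n.+1)%N by rewrite /n /q; lia.
have zu : tracks n.+1 (fun i => c (a k + q + i)%N) (fun i => z (a k + q + i)%N).
  by move=> h _; rewrite addnS; exact: zc.
have xu : tracks n.+1 (fun i => c (a k + q + i)%N) (fun i => x k (a k + q + i)%N).
  move=> h hn; rewrite addnS -addnA -addnS (cs k kl); last by lia.
  by rewrite [(a k + _.+1)%N]addnS -addnS; apply: sx; lia.
have gz := tracks_g_word zu; have gx := tracks_g_word xu.
rewrite !addn0 in gz gx; rewrite gz gx -addnA -qn.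
have cw : words (Sigma_M_on F C0) (mkseq (fun i => c (a k + q + i)%N) n.+1).
  by exists n.+1 => //; exists c => //; exists (a k + q)%N.
apply: (deltaP _ _ _ cw) zn; rewrite g_word_dom_mkseq qn addnA.
  exact: tracks_dom zu.
exact: tracks_dom xu.
Qed.
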